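(* Let $\rho:\Gamma\to G$ be a $(P^+,P^-)$-Anosov representation whose domain of discontinuity $M:=\Omega_\rho$ is a complex curve (complex manifold with $\dim_{\mathbb{C}}M=1$) on which $\rho(\Gamma)$ acts by biholomorphisms. For $g\in\rho(\Gamma)$ let $\mathcal{E}^g=g^*T^{1,0}M$. Then the action of $\Gamma$ via $\rho$ is properly discontinuous on $$\mathcal{H}=\coprod_{g\in\rho(\Gamma)}\{\text{Higgs bundle structures on }\mathcal{E}^g\}.$$
   Context: Anosov representations. $\Gamma$ is a finitely generated word hyperbolic group with boundary $\partial_\infty\Gamma$, and $\partial_\infty\Gamma^{(2)}=\partial_\infty\Gamma\times\partial_\infty\Gamma\setminus\{(t,t)\}$. $G$ is a semisimple Lie group, $(P^+,P^-)$ a pair of opposite parabolic subgroups, $\mathcal{F}^\pm=G/P^\pm$. A pair in $\mathcal{F}^+\times\mathcal{F}^-$ is transverse if it lies in the unique open $G$-orbit of the diagonal action (this orbit is $\cong G/(P^+\cap P^-)$). $\hat\Gamma$ is the (essentially unique) proper hyperbolic metric space with an action of $\Gamma\times(\mathbb{R}\rtimes\mathbb{Z}/2\mathbb{Z})$ such that $\Gamma\times\mathbb{Z}/2\mathbb{Z}$ acts isometrically, every orbit map $\Gamma\to\hat\Gamma$ is a quasi-isometry, the $\mathbb{R}$-action $\phi_t$ is free with quasi-isometrically embedded orbits, and the induced map $(\tau^+,\tau^-):\hat\Gamma/\mathbb{R}\to\partial_\infty\Gamma^{(2)}$ (endpoints of orbits) is a homeomorphism. A representation $\rho:\Gamma\to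 G$ is $(P^+,P^-)$-Anosov if there are continuous $\rho$-equivariant maps $\xi^\pm:\partial_\infty\Gamma\to\mathcal{F}^\pm$ such that (1) $(\xi^+(t^+),\xi^-(t^-))$ is transverse for all $(t^+,t^-)\in\partial_\infty\Gamma^{(2)}$; (2) for one (hence any) continuous equivariant family of norms $\|\cdot\|_{\hat m}$, $\hat m\in\hat\Gamma$, on $T_{\xi^+(\tau^+(\hat m))}\mathcal{F}^+$ (resp. $T_{\xi^-(\tau^-(\hat m))}\mathcal{F}^-$) there are $A,a>0$ with $\|e\|_{\phi_{-t}(\hat m)}\le Ae^{-at}\|e\|_{\hat m}$ (resp. $\|e\|_{\phi_t(\hat m)}\le Ae^{-at}\|e\|_{\hat m}$) for all $t\ge0$, $\hat m$, $e$. Domain of discontinuity. $\mathcal{X}=G/H$ with $H$ a parabolic or a symmetric subgroup of $G$. $M=\Omega_\rho\subset\mathcal{X}$ is a domain of discontinuity for $\rho$: an open $\rho(\Gamma)$-invariant subset such that for every compact $K\subset\Omega_\rho$ the set $\{\gamma\in\Gamma:\rho(\gamma)K\cap K\ne\emptyset\}$ is finite. An action of $\rho(\Gamma)$ on a topological space $X$ is called properly discontinuous if for every compact $K\subset X$ the set $\{\gamma\in\Gamma:\rho(\gamma)K\cap K\neq\emptyset\}$ is finite. Bundles and actions. $T^{1,0}M$ is the $(1,0)$-part of $TM\otimes_{\mathbb{R}}\mathbb{C}$, and $\mathcal{E}^g=\{(m,x)\in M\times T^{1,0}M: x\in T^{1,0}M|_{gm}\}$, $\mathcal{E}=\mathcal{E}^{e}=T^{1,0}M$.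 For $g,g'\in\rho(\Gamma)$ there is a holomorphic bundle isomorphism $g:\mathcal{E}^{g'}\to\mathcal{E}^{gg'}$ over $\mathrm{id}_M$, given over $m$ by the restriction of $dg|_{g'm}\otimes\mathrm{id}$ to $T^{1,0}M|_{g'm}\to T^{1,0}M|_{gg'm}$; it induces $g:\mathrm{End}(\mathcal{E}^{g'})\to\mathrm{End}(\mathcal{E}^{gg'})$ by conjugation and acts on $\mathrm{End}$-valued forms by $(g\varphi)(m)=(\mathrm{id}\otimes g)(\varphi(m))$. A pseudo-connection on a complex vector bundle $\mathbb{E}$ is a $\mathbb{C}$-linear operator $D:\Omega^0(M;\mathbb{E})\to\Omega^{0,1}(M;\mathbb{E})$ with $D(fs)=\bar\partial f\otimes s+fDs$ (extended to $\mathbb{E}$-valued forms by the Leibniz rule; $D^{\mathrm{End}(\mathbb{E})}$ is the induced pseudo-connection on $\mathrm{End}(\mathbb{E})$). For a pseudo-connection $D$ on $\mathcal{E}^{g'}$, $gD:=g\circ D\circ g^{-1}$ is a pseudo-connection on $\mathcal{E}^{gg'}$. $\mathfrak{D}^{\mathcal{E}^g}$ is the space of pseudo-connections on $\mathcal{E}^g$. A Higgs bundle structure on $\mathbb{E}$ is a pair $(D,\phi)$ with $D$ a pseudo-connection on $\mathbb{E}$ and $\phi\in\Omega^{1,0}(M;\mathrm{End}(\mathbb{E}))$ such that $D^2=0$, $D^{\mathrm{End}(\mathbb{E})}\phi=0$ and $\phi\wedge\phi=0$ (the first and last are automatic when $\dim_{\mathbb{C}}M=1$). $\rho(\Gamma)$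 acts on $\mathcal{H}$ diagonally: $g(D,\phi)=(gD,g\phi)$. Topology. $\Omega^{p,q}(M;\mathrm{End}(\mathcal{E}^g))$ has the topology of pointwise convergence, i.e. the subspace topology from $\prod_{m\in M}\bigl(\bigwedge^pT^{*1,0}M\otimes\bigwedge^qT^{*0,1}M\otimes\mathrm{End}(\mathcal{E}^g)\bigr)$ (copies of the total space of the bundle). Fix a pseudo-connection $D_0$ on $\mathcal{E}$; $\mathfrak{D}^{\mathcal{E}^g}$ is topologized so that $\Omega^{0,1}(M;\mathrm{End}(\mathcal{E}^g))\to\mathfrak{D}^{\mathcal{E}^g}$, $A\mapsto gD_0+A$, is a homeomorphism. $\mathcal{H}$ has the subspace topology from $\coprod_{g}\bigl(\mathfrak{D}^{\mathcal{E}^g}\times\Omega^{1,0}(M;\mathrm{End}(\mathcal{E}^g))\bigr)$. *)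

(* Defs.v *)
From HB Require Import structures.
From mathcomp Require Import all_boot all_order all_algebra.
From mathcomp Require Import all_classical all_reals all_analysis.
From mathcomp Require Import complex.

Set Implicit Arguments.
Unset Strict Implicit.
Unset Printing Implicit Defensive.

Import Order.TTheory GRing.Theory Num.Theory.
Import numFieldNormedType.Exports.

Local Open Scope classical_set_scope.
Local Open Scope ring_scope.
Local Open Scope complex_scope.

Definition properly_discontinuous (Gamma : Type) (T : topologicalType)
    (act : Gamma -> T -> T) (D : set T) : Prop :=
  forall K : set T, compact K -> K `<=` D ->
    finite_set [set gamma | (act gamma @` K) `&` K !=set0].

Section Manifold.
Variable R : realType.

Fixpoint Ck (n k : nat) (U : set 'rV[R]_n) (f : 'rV[R]_n -> R) : Prop :=
  (forall x, U x -> {for x, continuous f}) /\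
  (if k is k'.+1 then
     forall u : 'rV[R]_n, (forall x, U x -> derivable f x u) /\
                          Ck k' U (fun x => 'D_u f x)
   else True).

Definition Cinf_near (n : nat) (x : 'rV[R]_n) (f : 'rV[R]_n -> R) : Prop :=
  exists2 U : set 'rV[R]_n, open_nbhs x U & forall k, Ck k U f.

(* [cmap] and [cinv] are total; only their values on [cdom] and on
   [cmap @` cdom] are relevant. *)
Record chart (X : topologicalType) (n : nat) := Chart {
  cdom : set X;
  cmap : X -> 'rV[R]_n;
  cinv : 'rV[R]_n -> X }.

Definition chart_ok (X : topologicalType) n (c : chart X n) : Prop :=
  [/\ open (cdom c),
      open (cmap c @` cdom c),
      (forall x, cdom c x -> cinv c (cmap c x) = x),
      (forall x, cdom c x -> {for x, continuous (cmap c)}) &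
      (forall x, cdom c x -> {for cmap c x, continuous (cinv c)})].

Record manifold (n : nat) (X : topologicalType) := Manifold {
  atlas : set (chart X n);
  atlas_ok : forall c, atlas c -> chart_ok c;
  atlas_cover : forall x, exists2 c, atlas c & cdom c x;
  atlas_smooth : forall c c', atlas c -> atlas c' ->
    forall x, cdom c x -> cdom c' x ->
    forall j, Cinf_near (cmap c x) (fun w => cmap c' (cinv c w) 0 j);
  manifold_hausdorff : hausdorff_space X;
  manifold_second_countable : @second_countable X }.

(* [f] is smooth on some neighbourhood of [x]; it is arbitrary elsewhere. *)
Definition smooth_near n (X : topologicalType) (M : manifold n X)
    (x : X) (f : X -> R) : Prop :=
  exists c, [/\ atlas M c, cdom c x & Cinf_near (cmap c x) (f \o cinv c)].

Definition smooth_on n p (X Y : topologicalType) (M : manifold n X)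
    (N : manifold p Y) (U : set X) (F : X -> Y) : Prop :=
  forall x, U x -> {for x, continuous F} /\
    forall f, smooth_near N (F x) f -> smooth_near M x (f \o F).

Definition smooth_map n p (X Y : topologicalType) (M : manifold n X)
    (N : manifold p Y) (F : X -> Y) : Prop := smooth_on M N setT F.

(* Smoothness on the product manifold, read in product charts. *)
Definition smooth_near2 n p (X Y : topologicalType) (M : manifold n X)
    (N : manifold p Y) (x : X) (y : Y) (f : X -> Y -> R) : Prop :=
  exists c c', [/\ atlas M c, cdom c x, atlas N c', cdom c' y &
    Cinf_near (row_mx (cmap c x) (cmap c' y))
      (fun w => f (cinv c (lsubmx w)) (cinv c' (rsubmx w)))].

Definition smooth_map2 n p q (X Y Z : topologicalType) (M : manifold n X)
    (N : manifold p Y) (Q : manifold q Z) (F : X -> Y -> Z) : Prop :=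
  continuous (fun xy : X * Y => F xy.1 xy.2) /\
  forall x y f, smooth_near Q (F x y) f ->
    smooth_near2 M N x y (fun x' y' => f (F x' y')).

End Manifold.

(* Tangent vectors at a point are derivations of germs of real-valued smooth
   functions; vectors of the complexified tangent space are derivations with
   complex values.  They are represented as functionals on all functions, with
   value 0 on functions that are not smooth near the point.  A tangent space is
   thus a finite-dimensional linear subspace of a space of functions, and the
   topology of pointwise convergence induces its vector space topology. *)
Notation tvec R X := ((X -> R) -> R^o).
Notation cvec R X := ((X -> R) -> R[i]^o).

Section Tangent.
Variables (R : realType) (n : nat) (X : topologicalType) (M : manifold R n X).

Definition tangent (x : X) : set (tvec R X) := [set v |
  [/\ (forall (a : R) f g, smooth_near M x f -> smooth_near M x g ->
         v (fun y => a * f y + g y) = a * v f + v g),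
      (forall f g, smooth_near M x f -> smooth_near M x g ->
         v (fun y => f y * g y) = f x * v g + g x * v f) &
      (forall f, ~ smooth_near M x f -> v f = 0)]].

Definition re_vec (v : cvec R X) : tvec R X := fun f => complex.Re (v f).
Definition im_vec (v : cvec R X) : tvec R X := fun f => complex.Im (v f).

Definition complexify (A : set (tvec R X)) : set (cvec R X) :=
  [set v | A (re_vec v) /\ A (im_vec v)].

Definition ctangent (x : X) : set (cvec R X) := complexify (tangent x).

(* The value of the C-linear extension of [v] on a complex-valued function. *)
Definition capp (v : cvec R X) (f : X -> R[i]) : R[i] :=
  v (fun x => complex.Re (f x)) + 'i * v (fun x => complex.Im (f x)).

Definition csmooth_near (x : X) (f : X -> R[i]) : Prop :=
  smooth_near M x (fun y => complex.Re (f y)) /\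
  smooth_near M x (fun y => complex.Im (f y)).

Definition coord_vec (c : chart R X n) (x : X) (u : 'rV[R]_n) : tvec R X :=
  fun f => if `[< smooth_near M x f >] then 'D_u (f \o cinv c) (cmap c x) else 0.

End Tangent.

(* The differential of [F] on tangent vectors (real if [V] is [R], complex if
   [V] is [R[i]]).  It is only used for diffeomorphisms [F], for which it
   respects the convention on functions that are not smooth. *)
Definition push (R : realType) (X Y V : Type) (F : X -> Y)
  (v : (X -> R) -> V) : (Y -> R) -> V := fun f => v (f \o F).

Section LieAlgebra.
Variables (K : fieldType) (V : lmodType K) (br : V -> V -> V).
Implicit Types A B I : set V.

Definition lin_subspace A : Prop :=
  A 0 /\ forall (a : K) u v, A u -> A v -> A (a *: u + v).

Definition br_span A B : set V := [set w | forall W, lin_subspace W ->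
  (forall u v, A u -> B v -> W (br u v)) -> W w].

Definition lie_solvable A : Prop :=
  exists k, iter k (fun W => br_span W W) A `<=` [set 0].

Definition lie_nilpotent A : Prop :=
  exists k, iter k (fun W => br_span A W) A `<=` [set 0].

Definition lie_subalgebra A B : Prop :=
  [/\ lin_subspace B, B `<=` A & forall u v, B u -> B v -> B (br u v)].

Definition lie_ideal A I : Prop :=
  [/\ lin_subspace I, I `<=` A & forall u v, A u -> I v -> I (br u v)].

Definition lie_semisimple A : Prop :=
  forall I, lie_ideal A I -> lie_solvable I -> I `<=` [set 0].

Definition borel_subalgebra A B : Prop :=
  [/\ lie_subalgebra A B, lie_solvable B &
      forall B', lie_subalgebra A B' -> lie_solvable B' -> B `<=` B' -> B' `<=` B].

(* A sum of two nilpotent ideals is nilpotent, so in finite dimension this union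
   is the largest nilpotent ideal. *)
Definition nilradical A : set V :=
  [set v | exists2 I, lie_ideal A I /\ lie_nilpotent I & I v].

Definition direct_sum A B C : Prop :=
  A = [set w | exists2 u, B u & exists2 v, C v & w = u + v] /\
  B `&` C `<=` [set 0].

End LieAlgebra.

HB.structure Definition TopGroup := {T of Topological T & Group T}.
Notation topGroupType := TopGroup.type.

Section LieGroup.
Variables (R : realType) (n : nat) (G : topGroupType) (MG : manifold R n G).

Definition lie_group : Prop :=
  smooth_map2 MG MG MG (fun g h : G => (g * h)%g) /\
  smooth_map MG MG (fun g : G => (g^-1)%g).

Definition lie_alg : set (tvec R G) := tangent MG 1%g.

(* The value at 1 of the commutator of the left-invariant vector fields
   extending [v] and [w]. *)
Definition bracket (v w : tvec R G) : tvec R G := fun f =>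
  if `[< smooth_near MG 1%g f >] then
    v (fun g => w (fun h => f (g * h)%g)) - w (fun g => v (fun h => f (g * h)%g))
  else 0.

(* The C-bilinear extension of [bracket]. *)
Definition cbracket (v w : cvec R G) : cvec R G := fun f =>
  (bracket (re_vec v) (re_vec w) f - bracket (im_vec v) (im_vec w) f) +i*
  (bracket (re_vec v) (im_vec w) f + bracket (im_vec v) (re_vec w) f).

Definition semisimple_group : Prop := lie_semisimple bracket lie_alg.

Definition Ad (g : G) (v : tvec R G) : tvec R G :=
  push (fun h : G => (g * h * g^-1)%g) v.

Definition parabolic_subalgebra (p : set (tvec R G)) : Prop :=
  lie_subalgebra bracket lie_alg p /\
  exists2 b, borel_subalgebra cbracket (complexify lie_alg) b &
             b `<=` complexify p.

Definition normalizer (p : set (tvec R G)) : set G := [set g | Ad g @` p = p].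

Definition parabolic_subgroup (P : set G) : Prop :=
  exists2 p, parabolic_subalgebra p & P = normalizer p.

(* The intersection is a Levi factor of both. *)
Definition opposite_parabolics (P Q : set G) : Prop :=
  exists p q, [/\ parabolic_subalgebra p, parabolic_subalgebra q,
    P = normalizer p, Q = normalizer q &
    direct_sum p (p `&` q) (nilradical bracket p) /\
    direct_sum q (p `&` q) (nilradical bracket q)].

Definition symmetric_subgroup (H : set G) : Prop :=
  [/\ H 1%g, (forall g h, H g -> H h -> H (g * h^-1)%g) &
  exists sigma : G -> G,
    [/\ smooth_map MG MG sigma,
        {morph sigma : g h / (g * h)%g},
        (forall g, sigma (sigma g) = g),
        H `<=` [set g | sigma g = g] &
        connected_component [set g | sigma g = g] 1%g `<=` H]].

(* The manifold [X] is G/H: [hproj] is the quotient map, and the existence of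
   smooth local sections determines the topology and the smooth structure. *)
Record homogeneous_space (H : set G) (m : nat) (X : topologicalType)
    (MX : manifold R m X) := HomogeneousSpace {
  hproj : G -> X;
  hact : G -> X -> X;
  hproj_surj : forall x, exists g, hproj g = x;
  hproj_fiber : forall g g', hproj g = hproj g' <-> H (g^-1 * g')%g;
  hproj_smooth : smooth_map MG MX hproj;
  hproj_section : forall x, exists U sigma, [/\ open_nbhs x U,
    smooth_on MX MG U sigma & forall y, U y -> hproj (sigma y) = y];
  hact_proj : forall g g', hact g (hproj g') = hproj (g * g')%g }.

End LieGroup.

Section Hyperbolic.
Variable R : realType.

Definition gromov_product (T : Type) (d : T -> T -> R) (o x y : T) : R :=
  (d x o + d y o - d x y) / 2%:R.

Definition gromov_hyperbolic (T : Type) (d : T -> T -> R) : Prop :=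
  exists delta : R, forall o x y z,
    Num.min (gromov_product d o x y) (gromov_product d o y z) - delta
      <= gromov_product d o x z.

Definition seq_equiv (T : Type) (d : T -> T -> R) (o : T) (x y : nat -> T) : Prop :=
  forall r : R, exists N, forall i j, (N <= i)%N -> (N <= j)%N ->
    r <= gromov_product d o (x i) (y j).

Definition qi_embedding (T U : Type) (d : T -> T -> R) (e : U -> U -> R)
    (f : T -> U) : Prop :=
  exists L C : R, [/\ 1 <= L, 0 <= C & forall x y,
    d x y / L - C <= e (f x) (f y) /\ e (f x) (f y) <= L * d x y + C].

Definition quasi_isometry (T U : Type) (d : T -> T -> R) (e : U -> U -> R)
    (f : T -> U) : Prop :=
  qi_embedding d e f /\ exists C : R, forall u, exists x, e (f x) u <= C.

Section Group.
Variables (Gamma : groupType) (S : seq Gamma).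

Definition word_for (gamma : Gamma) (w : seq Gamma) : Prop :=
  all (fun s => (s \in S) || ((s^-1)%g \in S)) w /\
  foldr (fun s t => (s * t)%g) 1%g w = gamma.

Definition generates : Prop := forall gamma, exists w, word_for gamma w.

Definition word_length (gamma : Gamma) : R :=
  inf [set (size w)%:R | w in word_for gamma].

Definition word_dist (x y : Gamma) : R := word_length (x^-1 * y)%g.

Definition word_hyperbolic : Prop := gromov_hyperbolic word_dist.

(* A boundary point is an equivalence class of sequences going to infinity. *)
Definition boundary_class (c : set (nat -> Gamma)) : Prop :=
  exists x, seq_equiv word_dist 1%g x x /\
    c = [set y | seq_equiv word_dist 1%g y y /\ seq_equiv word_dist 1%g x y].

Definition boundary : Type := {c : set (nat -> Gamma) | boundary_class c}.

HB.instance Definition _ := gen_eqMixin boundary.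
HB.instance Definition _ := gen_choiceMixin boundary.

Definition boundary_nbhd (p : boundary) (r : R) : set boundary :=
  [set q | exists x y, [/\ sval p x, sval q y &
     exists N, forall i j, (N <= i)%N -> (N <= j)%N ->
       r <= gromov_product word_dist 1%g (x i) (y j)]].

Definition boundary_open (O : set boundary) : Prop :=
  forall p, O p -> exists r, boundary_nbhd p r `<=` O.

Let boundary_openT : boundary_open setT.
Proof. by move=> p _; exists 0. Qed.

Let boundary_openI (A B : set boundary) :
  boundary_open A -> boundary_open B -> boundary_open (A `&` B).
Proof.
move=> oA oB p [Ap Bp].
have [r hr] := oA _ Ap; have [s hs] := oB _ Bp.
exists (Num.max r s) => q [x [y [px qy [N hN]]]]; split.
- apply: hr; exists x, y; split => //; exists N => i j Ni Nj.
  by move: (hN _ _ Ni Nj); rewrite ge_max => /andP[].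
- apply: hs; exists x, y; split => //; exists N => i j Ni Nj.
  by move: (hN _ _ Ni Nj); rewrite ge_max => /andP[].
Qed.

Let boundary_open_bigU (I : Type) (f : I -> set boundary) :
  (forall i, boundary_open (f i)) -> boundary_open (\bigcup_i f i).
Proof.
move=> of_ p [i _ fip]; have [r hr] := of_ i _ fip.
by exists r => q /hr fiq; exists i.
Qed.

HB.instance Definition _ := isOpenTopological.Build boundary
  boundary_openT boundary_openI boundary_open_bigU.

(* [q] is the image of [p] under [gamma]. *)
Definition boundary_translate (gamma : Gamma) (p q : boundary) : Prop :=
  exists2 x, sval p x & sval q (fun k => (gamma * x k)%g).

Definition boundary_pairs : set (boundary * boundary) :=
  [set pq | pq.1 <> pq.2].

Record flow_space (Y : metricType R) := FlowSpace {
  fs_act : Gamma -> Y -> Y;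
  fs_flow : R -> Y -> Y;
  fs_inv : Y -> Y;
  fs_plus : Y -> boundary;
  fs_minus : Y -> boundary;
  fs_proper : forall (y : Y) (r : R), compact [set z | mdist y z <= r];
  fs_hyperbolic : gromov_hyperbolic (@mdist R Y);
  fs_act1 : forall y, fs_act 1%g y = y;
  fs_actM : forall g h y, fs_act (g * h)%g y = fs_act g (fs_act h y);
  fs_flow0 : forall y, fs_flow 0 y = y;
  fs_flowD : forall s t y, fs_flow (s + t) y = fs_flow s (fs_flow t y);
  fs_flow_continuous : continuous (fun p : R * Y => fs_flow p.1 p.2);
  fs_invK : forall y, fs_inv (fs_inv y) = y;
  fs_act_flow : forall g t y, fs_act g (fs_flow t y) = fs_flow t (fs_act g y);
  fs_act_inv : forall g y, fs_act g (fs_inv y) = fs_inv (fs_act g y);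
  fs_inv_flow : forall t y, fs_inv (fs_flow t y) = fs_flow (- t) (fs_inv y);
  fs_act_isometry : forall g y z, mdist (fs_act g y) (fs_act g z) = mdist y z;
  fs_inv_isometry : forall y z, mdist (fs_inv y) (fs_inv z) = mdist y z;
  fs_orbit : forall y, quasi_isometry word_dist (@mdist R Y) (fs_act^~ y);
  fs_free : forall t y, fs_flow t y = y -> t = 0;
  fs_flow_qi : forall y,
    qi_embedding (fun s t : R => `|s - t|) (@mdist R Y) (fs_flow^~ y);
  (* the boundaries of Gamma and Y are identified through orbit maps *)
  fs_plusP : forall y, exists2 x, sval (fs_plus y) x &
    seq_equiv (@mdist R Y) y (fun k => fs_act (x k) y) (fun k => fs_flow k%:R y);
  fs_minusP : forall y, exists2 x, sval (fs_minus y) x &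
    seq_equiv (@mdist R Y) y (fun k => fs_act (x k) y)
      (fun k => fs_flow (- k%:R) y);
  fs_ends : range (fun y => (fs_plus y, fs_minus y)) = boundary_pairs;
  fs_ends_inj : forall y z, (fs_plus y, fs_minus y) = (fs_plus z, fs_minus z) ->
    exists t, z = fs_flow t y;
  fs_ends_flow : forall t y, (fs_plus (fs_flow t y), fs_minus (fs_flow t y)) =
    (fs_plus y, fs_minus y);
  (* homeomorphism from the orbit space, for the quotient topology *)
  fs_ends_homeo : forall A : set (boundary * boundary), A `<=` boundary_pairs ->
    (exists2 V, open V & A = V `&` boundary_pairs) <->
    open [set y | A (fs_plus y, fs_minus y)] }.

End Group.
End Hyperbolic.

Section Anosov.
Variables (R : realType) (Gamma : groupType) (S : seq Gamma).
Variables (Y : metricType R) (fs : flow_space S Y).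
Variables (n : nat) (G : topGroupType) (MG : manifold R n G).
Variables (rho : {multiplicative Gamma -> G}).

Section OneSide.
Variables (P : set G) (m : nat) (F : topologicalType) (MF : manifold R m F).
Variable (hF : homogeneous_space MG P MF).
Variables (xi : boundary R S -> F) (tau : Y -> boundary R S).

Definition equivariant_map : Prop := forall gamma p q,
  boundary_translate gamma p q -> xi q = hact hF (rho gamma) (xi p).

Definition norm_on (T : set (tvec R F)) (N : tvec R F -> R) : Prop :=
  [/\ (forall v, T v -> 0 <= N v),
      (forall v, T v -> N v = 0 -> v = 0),
      (forall (a : R) v, T v -> N (a *: v) = `|a| * N v) &
      (forall v w, T v -> T w -> N (v + w) <= N v + N w)].

(* A norm on each fibre of the pull-back of TF along [xi \o tau]; continuity on
   the total space is read in the trivializations given by charts of F. *)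
Definition continuous_equivariant_norms (N : Y -> tvec R F -> R) : Prop :=
  [/\ (forall y, norm_on (tangent MF (xi (tau y))) (N y)),
      (forall c, atlas MF c -> forall y (u : 'rV[R]_m), cdom c (xi (tau y)) ->
         {for (y, u), continuous (fun p : Y * 'rV[R]_m =>
            N p.1 (coord_vec MF c (xi (tau p.1)) p.2))}) &
      (forall gamma y e, tangent MF (xi (tau y)) e ->
         N (fs_act fs gamma y) (push (hact hF (rho gamma)) e) = N y e)].

Definition contracted_along (flow : R -> Y -> Y) : Prop :=
  exists2 N, continuous_equivariant_norms N &
  exists A a : R, [/\ 0 < A, 0 < a & forall t y e, 0 <= t ->
    tangent MF (xi (tau y)) e -> N (flow t y) e <= A * expR (- a * t) * N y e].

End OneSide.

Variables (Pp Pm : set G) (mp mm : nat) (Fp Fm : topologicalType).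
Variables (MFp : manifold R mp Fp) (MFm : manifold R mm Fm).
Variables (hFp : homogeneous_space MG Pp MFp) (hFm : homogeneous_space MG Pm MFm).

(* The G-orbit of the pair is open. *)
Definition transverse (x : Fp) (y : Fm) : Prop :=
  open (range (fun g : G => (hact hFp g x, hact hFm g y))).

Definition anosov : Prop :=
  exists (xip : boundary R S -> Fp) (xim : boundary R S -> Fm),
  [/\ continuous xip /\ continuous xim,
      equivariant_map hFp xip /\ equivariant_map hFm xim,
      (forall tp tm, tp <> tm -> transverse (xip tp) (xim tm)) &
      contracted_along hFp xip (fs_plus fs) (fun t => fs_flow fs (- t)) /\
      contracted_along hFm xim (fs_minus fs) (fs_flow fs)].

End Anosov.

Definition domain_of_discontinuity (Gamma : Type) (X : topologicalType)
    (act : Gamma -> X -> X) (Omega : set X) : Prop :=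
  [/\ open Omega, (forall gamma x, Omega x -> Omega (act gamma x)) &
      properly_discontinuous act Omega].

Section ComplexCurve.
Variables (R : realType) (n : nat) (X : topologicalType) (MX : manifold R n X).

Definition toC (w : 'rV[R]_2) : R[i] := w 0 0 +i* w 0 1.
Definition ofC (z : R[i]) : 'rV[R]_2 :=
  \row_j (if j == 0 then complex.Re z else complex.Im z).

(* A structure of complex manifold of dimension 1 on the open subset [Omega] of
   [X], compatible with its smooth structure.  A complex chart is a chart with
   values in R^2 = C; the compatibility condition forces n = 2. *)
Record complex_curve (Omega : set X) := ComplexCurve {
  catlas : set (chart R X 2);
  catlas_ok : forall c, catlas c -> chart_ok c /\ cdom c `<=` Omega;
  catlas_cover : forall x, Omega x -> exists2 c, catlas c & cdom c x;
  catlas_smooth : forall c, catlas c -> forall x, cdom c x -> forall f,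
    smooth_near MX x f <-> Cinf_near (cmap c x) (f \o cinv c);
  catlas_holo : forall c c', catlas c -> catlas c' ->
    forall x, cdom c x -> cdom c' x ->
    derivable ((fun z => toC (cmap c' (cinv c (ofC z)))) : R[i]^o -> R[i]^o)
      (toC (cmap c x)) 1;
  curve_nonempty : Omega !=set0 }.

Variables (Omega : set X) (CC : complex_curve Omega).

Definition holo_near (x : X) (f : X -> R[i]) : Prop :=
  exists c, [/\ catlas CC c, cdom c x &
    \forall z \near (toC (cmap c x) : R[i]^o),
      derivable ((fun z => f (cinv c (ofC z))) : R[i]^o -> R[i]^o) z 1].

Definition holomorphic_map (h : X -> X) : Prop :=
  forall x, Omega x -> [/\ Omega (h x), {for x, continuous h} &
    forall f, holo_near (h x) f -> holo_near x (f \o h)].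

(* [w = J v] for the C-linear extension of the complex structure J of TM: for a
   holomorphic function x + iy, dx o J = - dy and dy o J = dx. *)
Definition is_J (x : X) (v w : cvec R X) : Prop :=
  forall f, holo_near x f ->
    w (fun y => complex.Re (f y)) = - v (fun y => complex.Im (f y)) /\
    w (fun y => complex.Im (f y)) = v (fun y => complex.Re (f y)).

Definition T10 (x : X) : set (cvec R X) :=
  [set v | ctangent MX x v /\ is_J x v ('i *: v)].
Definition T01 (x : X) : set (cvec R X) :=
  [set v | ctangent MX x v /\ is_J x v (- 'i *: v)].

(* Smooth sections over [Omega] of a subbundle, with fibre [E x] at [x], of the
   pull-back of the complexified tangent bundle by [h]; they are extended by 0
   outside [Omega]. *)
Definition smooth_section (h : X -> X) (E : X -> set (cvec R X))
    (s : X -> cvec R X) : Prop :=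
  [/\ (forall x, Omega x -> E x (s x)),
      (forall x, ~ Omega x -> s x = 0) &
      (forall x f, Omega x -> smooth_near MX (h x) f ->
         csmooth_near MX x (fun y => s y f))].

Definition vfield (s : X -> cvec R X) : Prop := smooth_section id (ctangent MX) s.
Definition vfield10 (s : X -> cvec R X) : Prop := smooth_section id T10 s.
Definition vfield01 (s : X -> cvec R X) : Prop := smooth_section id T01 s.

Definition vbracket (v w : X -> cvec R X) (x : X) : cvec R X := fun f =>
  if `[< smooth_near MX x f >] then
    capp (v x) (fun y => w y f) - capp (w x) (fun y => v y f)
  else 0.

End ComplexCurve.

(* [sect], [vform] and [endform] contain the sections of E^g, the E^g-valued
   1-forms and the End(E^g)-valued 1-forms, all extended by 0; [conn_op]
   contains the operators from sections to E^g-valued 1-forms. *)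
Notation sect R X := (X -> cvec R X).
Notation vform R X := (X -> cvec R X -> cvec R X).
Notation endform R X := (X -> cvec R X -> cvec R X -> cvec R X).
Notation conn_op R X := (sect R X -> vform R X).

Section Higgs.
Variables (R : realType) (n : nat) (X : topologicalType) (MX : manifold R n X).
Variables (Omega : set X) (CC : complex_curve MX Omega).
Variables (G : topGroupType) (act : G -> X -> X).

Definition fibre (g : G) (x : X) : set (cvec R X) := T10 CC (act g x).

Definition section (g : G) (s : sect R X) : Prop :=
  smooth_section MX Omega (act g) (fibre g) s.

Definition clinear_on (T : set (cvec R X)) (f : cvec R X -> cvec R X) : Prop :=
  (forall (a : R[i]) v w, T v -> T w -> f (a *: v + w) = a *: f v + f w) /\
  (forall v, ~ T v -> f v = 0).

Definition form01 (g : G) (alpha : vform R X) : Prop :=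
  [/\ (forall x, Omega x -> clinear_on (ctangent MX x) (alpha x)),
      (forall x v, Omega x -> ctangent MX x v -> fibre g x (alpha x v)),
      (forall x v, Omega x -> T10 CC x v -> alpha x v = 0),
      (forall x v, ~ Omega x -> alpha x v = 0) &
      (forall Y, vfield MX Omega Y -> section g (fun x => alpha x (Y x)))].

Definition endform_on (g : G) (phi : endform R X) : Prop :=
  [/\ (forall x e, Omega x -> clinear_on (ctangent MX x) (phi x ^~ e)),
      (forall x v, Omega x -> clinear_on (fibre g x) (phi x v)),
      (forall x v e, Omega x -> ctangent MX x v -> fibre g x e ->
         fibre g x (phi x v e)),
      (forall x v e, ~ Omega x -> phi x v e = 0) &
      (forall Y s, vfield MX Omega Y -> section g s ->
         section g (fun x => phi x (Y x) (s x)))].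

Definition endform10 (g : G) (phi : endform R X) : Prop :=
  endform_on g phi /\ forall x v e, Omega x -> T01 CC x v -> phi x v e = 0.

Definition endform01 (g : G) (phi : endform R X) : Prop :=
  endform_on g phi /\ forall x v e, Omega x -> T10 CC x v -> phi x v e = 0.

(* The Leibniz rule is stated on (0,1)-vectors, where [dbar f] is [df]; on
   (1,0)-vectors both sides vanish. *)
Definition pseudo_connection (g : G) (D : conn_op R X) : Prop :=
  [/\ (forall s, section g s -> form01 g (D s)),
      (forall s, ~ section g s -> D s = 0),
      (forall (a : R[i]) s t, section g s -> section g t ->
         D (fun x => a *: s x + t x) = (fun x v => a *: D s x v + D t x v)) &
      (forall (f : X -> R[i]) s,
         (forall x, Omega x -> csmooth_near MX x f) -> section g s ->
         forall x v, Omega x -> T01 CC x v ->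
           D (fun y => f y *: s y) x v = capp v f *: s x + f x *: D s x v)].

(* With [D_v s = D s x v], the extension of D to forms by the Leibniz rule gives
     (D^2 s)(v, w) = D_v D_w s - D_w D_v s - D_[v, w] s
   for vector fields v, w of type (0,1), and for a (1,0)-form phi, v of type
   (0,1) and w of type (1,0), where [D_v (phi w)] is the induced derivative of an
   endomorphism,
     (D phi)(v, w) = D_v (phi w) - phi [v, w].
   These evaluations determine the forms, which have type (0,2) and (1,1). *)
Definition square_zero (g : G) (D : conn_op R X) : Prop :=
  forall s v w, section g s -> vfield01 CC v -> vfield01 CC w ->
  forall x, Omega x ->
    D (fun y => D s y (w y)) x (v x) - D (fun y => D s y (v y)) x (w x)
      - D s x (vbracket MX v w x) = 0.

Definition end_parallel (g : G) (D : conn_op R X) (phi : endform R X) : Prop :=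
  forall s v w, section g s -> vfield01 CC v -> vfield10 CC w ->
  forall x, Omega x ->
    (D (fun y => phi y (w y) (s y)) x (v x) - phi x (w x) (D s x (v x)))
      - phi x (vbracket MX v w x) (s x) = 0.

Definition wedge_zero (g : G) (phi : endform R X) : Prop :=
  forall x v w e, Omega x -> ctangent MX x v -> ctangent MX x w -> fibre g x e ->
    phi x v (phi x w e) - phi x w (phi x v e) = 0.

Definition higgs_structure (g : G) (D : conn_op R X) (phi : endform R X) : Prop :=
  [/\ pseudo_connection g D, endform10 g phi, square_zero g D,
      end_parallel g D phi & wedge_zero g phi].

(* The isomorphism [h : E^g' -> E^(h g')] on sections, operators and forms. *)
Definition push_sect (h : G) (s : sect R X) : sect R X :=
  fun x => push (act h) (s x).
Definition push_conn (h : G) (D : conn_op R X) : conn_op R X :=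
  fun s x v => push (act h) (D (push_sect h^-1%g s) x v).
Definition push_form (h : G) (phi : endform R X) : endform R X :=
  fun x v e => push (act h) (phi x v (push (act h^-1%g) e)).

Definition endform_ptws : Type := {ptws X -> {ptws (cvec R X) -> {ptws (cvec R X)
  -> {ptws (X -> R) -> R[i]^o}}}}.
HB.instance Definition _ := Topological.on endform_ptws.

Variable D0 : conn_op R X.

(* The inverse of the bijection A |-> g D0 + A from End(E^g)-valued (0,1)-forms
   to pseudo-connections on E^g. *)
Definition conn_form (g : G) (D : conn_op R X) : endform_ptws :=
  xget ((fun _ _ _ _ => 0) : endform_ptws) [set A | endform01 g A /\
    forall s, section g s -> D s = fun x v => push_conn g D0 s x v + A x v (s x)].

(* All operators, with the initial topology along [conn_form g]; the subspace of
   pseudo-connections on E^g carries the topology for which A |-> g D0 + A is a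
   homeomorphism. *)
Definition conn_space (g : G) : Type := initial_topology (conn_form g).
HB.instance Definition _ (g : G) := Topological.on (conn_space g).

Variables (Gamma : groupType) (rho : {multiplicative Gamma -> G}).

Definition rho_image : choiceType := set_type (range rho).

Lemma rho_mul_subproof (gamma : Gamma) (g : rho_image) :
  (rho gamma * val g)%g \in range rho.
Proof.
case: g => g /= /set_mem[h _ <-]; apply/mem_set.
by exists (gamma * h)%g => //; rewrite gmulfM.
Qed.

Definition rho_mul (gamma : Gamma) (g : rho_image) : rho_image :=
  SigSub (rho_mul_subproof gamma g).

(* The coproduct of the spaces of all pairs of an operator and a form; the Higgs
   bundle structures form a subspace. *)
Definition higgs_ambient : Type :=
  {g : rho_image & (conn_space (val g) * endform_ptws)%type}.
HB.instance Definition _ := Topological.on higgs_ambient.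

Definition higgs_space : set higgs_ambient := [set x |
  let: existT g (D, phi) := x in higgs_structure (val g) D phi].

Definition higgs_act (gamma : Gamma) (x : higgs_ambient) : higgs_ambient :=
  let: existT g (D, phi) := x in
  existT (fun g : rho_image => (conn_space (val g) * endform_ptws)%type)
    (rho_mul gamma g) (push_conn (rho gamma) D, push_form (rho gamma) phi).

End Higgs.

(* Main.v *)
(* Only the index of the component matters. Fix a point x of Omega. A compact
   subset K of the coproduct meets finitely many components, with indices g in a
   finite set F, so K' = {g x | g in F} is a finite subset of Omega. If gamma
   maps a point of K in the component g to a point of K in the component g', then
   rho(gamma) g = g', so rho(gamma) maps the point g x of K' to the point g' x of
   K'; proper discontinuity on Omega leaves finitely many such gamma. *)

Require Import Defs.
From HB Require Import structures.
From mathcomp Require Import all_boot all_order all_algebra.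
From mathcomp Require Import all_classical all_reals all_analysis.
From mathcomp Require Import complex.

Set Implicit Arguments.
Unset Strict Implicit.
Unset Printing Implicit Defensive.

Local Open Scope classical_set_scope.

Lemma compact_finite_tags (I : choiceType) (T : I -> topologicalType)
    (K : set {i & T i}) :
  compact K -> finite_set (@projT1 I T @` K).
Proof.
(* Near covering along the cofinite filter, for the property "the tag of y
   differs from i". *)
move/compact_near_coveringP => cK; pose F A := finite_set (~` A : set I).
have FF : Filter F.
  split; first by rewrite /F setCT.
  - by move=> A B fA fB; rewrite /F setCI finite_setU.
  - by move=> A B /subsetC; exact: sub_finite_set.
(* Near covering makes the indices missed by [K] cofinite; the tags of [K] lie in the complement. *)
suff: finite_set (~` [set i | K `<=` [set y | projT1 y <> i]]).
  by apply/sub_finite_set => i [y Ky <-] /(_ y Ky).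
apply: (cK I F (fun i y => projT1 y <> i) FF) => -[i y] Ky.
(* The whole component of [i] is a neighbourhood, and its points have a tag different from every
   index other than [i]. *)
exists (existT T i @` setT, ~` [set i]).
  split; last by have : F (~` [set i]) by rewrite /F setCK.
  by apply: (@existT_nbhs _ T i y); exact: filterT.
by move=> [_ j] /= [[z _ <-] /= ij] /esym.
Qed.

Lemma hactM (R : realType) n (G : topGroupType) (MG : manifold R n G)
    (H : set G) m (X : topologicalType) (MX : manifold R m X)
    (hX : homogeneous_space MG H MX) (g h : G) (x : X) :
  hact hX (g * h)%g x = hact hX g (hact hX h x).
Proof. by have [k <-] := hproj_surj hX x; rewrite !hact_proj mulgA. Qed.

Theorem theorem1p3 (R : realType)
  (Gamma : groupType) (S : seq Gamma) (Sgen : generates S)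
  (Shyp : word_hyperbolic R S)
  (Y : metricType R) (fs : flow_space S Y)
  (nG : nat) (G : topGroupType) (MG : manifold R nG G)
  (lieG : lie_group MG) (ssG : semisimple_group MG)
  (Pp Pm : set G) (oppP : opposite_parabolics MG Pp Pm)
  (np nm : nat) (Fp Fm : topologicalType)
  (MFp : manifold R np Fp) (MFm : manifold R nm Fm)
  (hFp : homogeneous_space MG Pp MFp) (hFm : homogeneous_space MG Pm MFm)
  (rho : {multiplicative Gamma -> G}) (rhoA : anosov fs rho hFp hFm)
  (H : set G) (hH : parabolic_subgroup MG H \/ symmetric_subgroup MG H)
  (nX : nat) (X : topologicalType) (MX : manifold R nX X)
  (hX : homogeneous_space MG H MX)
  (Omega : set X)
  (dod : domain_of_discontinuity (fun gamma => hact hX (rho gamma)) Omega)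
  (CC : complex_curve MX Omega)
  (hol : forall gamma, holomorphic_map CC (hact hX (rho gamma)))
  (D0 : conn_op R X) (hD0 : pseudo_connection CC (hact hX) 1%g D0) :
  properly_discontinuous
    (@higgs_act R nX X MX Omega CC G (hact hX) D0 Gamma rho)
    (@higgs_space R nX X MX Omega CC G (hact hX) D0 Gamma rho).
Proof.
case: dod => _ stable pd K cK _; have [x Ox] := curve_nonempty CC.
pose K' := (fun g : rho_image rho => hact hX (val g) x) @` (@projT1 _ _ @` K).
have finK' : finite_set K' by apply/finite_image/compact_finite_tags.
have K'O : K' `<=` Omega.
  (* Each index is some [rho h], which preserves [Omega]. *)
  by move=> _ [[g gP] _ <-] /=; have [h _ <-] := set_mem gP; exact: stable.
apply: (sub_finite_set _ (pd _ (finite_compact finK') K'O)).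
move=> gamma [z [[y Ky yz] Kz]]; exists (hact hX (val (projT1 z)) x); split.
- exists (hact hX (val (projT1 y)) x); first by exists (projT1 y) => //; exists y.
  (* Destructing [y] lets [higgs_act] compute: the index of [z] is [rho gamma] times that of [y]. *)
  by rewrite -hactM -yz; case: {Ky yz} y => g [].
- by exists (projT1 z) => //; exists z.
Qed.
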